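(* Let $G$ be a finite gyrogroup and let $\mathbb{F}$ be a field such that $\mathrm{char}\,\mathbb{F}\neq 0$ and $\mathrm{char}\,\mathbb{F}$ divides $|G|$. If $\sigma(f)\neq 0$ for some $f\in L^{\mathrm{gyr}}(G)$, then $L^{\mathrm{gyr}}(G)\cap\ker\sigma$ does not possess an invariant direct sum complement in $L^{\mathrm{gyr}}(G)$; that is, there is no invariant subspace $W$ of $L^{\mathrm{gyr}}(G)$ (under the left regular action of $G$) such that $L^{\mathrm{gyr}}(G) = (L^{\mathrm{gyr}}(G)\cap\ker\sigma)\oplus W$.
   Context: A gyrogroup is a nonempty set $G$ with a binary operation $\oplus$ such that: (G1) there is an element $e\in G$ with $e\oplus a=a$ for all $a\in G$; (G2) for each $a\in G$ there is $b\in G$ with $b\oplus a=e$; (G3) for all $a,b\in G$ there is an automorphism $\mathrm{gyr}[a,b]$ of $(G,\oplus)$ (a bijection of $G$ preserving $\oplus$) such that $a\oplus(b\oplus c)=(a\oplus b)\oplus \mathrm{gyr}[a,b]c$ for all $c\in G$; (G4) $\mathrm{gyr}[a\oplus b,b]=\mathrm{gyr}[a,b]$ for all $a,b\in G$. In any gyrogroup, $e$ is the unique two-sided identity and each $a$ has a unique two-sided inverse, denoted $\ominus a$. $L(G)$ is the $\mathbb{F}$-vector space of all functions $G\to\mathbb{F}$ with pointwise operations, and $$L^{\mathrm{gyr}}(G)=\{f\in L(G)\colon \forall a,x,y,z\in G,\ f(a\oplus\mathrm{gyr}[x,y]z)=f(a\oplus z)\},$$ a subspace of $L(G)$. For finite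 $G$, $\sigma\colon L(G)\to\mathbb{F}$ is defined by $\sigma(f)=\sum_{a\in G}f(a)$. For $a\in G$, $L_a\colon G\to G$ is $L_a(x)=a\oplus x$. The left regular action of $G$ on $L^{\mathrm{gyr}}(G)$ is the linear action $a\cdot f=f\circ L_{\ominus a}$ for $a\in G$, $f\in L^{\mathrm{gyr}}(G)$. A subspace $W$ of $L^{\mathrm{gyr}}(G)$ is invariant if $a\cdot w\in W$ for all $a\in G$, $w\in W$. *)

(* Defs.v *)
From HB Require Import structures.
From mathcomp Require Import all_boot all_order all_algebra.

Set Implicit Arguments.
Unset Strict Implicit.
Unset Printing Implicit Defensive.

Import GRing.Theory.
Local Open Scope ring_scope.

Declare Scope gyro_scope.
Delimit Scope gyro_scope with gyro.

(* The identity, the left inverses and the gyroautomorphisms are carried as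
   data. This adds nothing to the usual existential axioms: each of them is
   uniquely determined by gadd, see gyro_idP, goppP and gyrP below. *)
HB.mixin Record isGyrogroup G := {
  gid : G;
  gopp : G -> G;
  gadd : G -> G -> G;
  gyr : G -> G -> G -> G;
  gadd_idl : left_id gid gadd;
  gadd_oppl : left_inverse gid gopp gadd;
  gyr_bij : forall a b, bijective (gyr a b);
  gyr_morph : forall a b, {morph gyr a b : x y / gadd x y};
  gyr_assoc : forall a b c, gadd a (gadd b c) = gadd (gadd a b) (gyr a b c);
  gyr_loop : forall a b, gyr (gadd a b) b = gyr a b
}.

#[short(type="gyrogroupType")]
HB.structure Definition Gyrogroup := {G of isGyrogroup G}.

#[short(type="finGyrogroupType")]
HB.structure Definition FinGyrogroup := {G of Finite G & isGyrogroup G}.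

Notation "a ⊕ b" := (gadd a b) (at level 50, left associativity) : gyro_scope.
Notation "⊖ a" := (gopp a) (at level 35, right associativity) : gyro_scope.
Local Open Scope gyro_scope.

Section GyrogroupTheory.
Variable G : gyrogroupType.
Implicit Types a b c x : G.

Lemma gadd_cancel a : injective (gadd a).
Proof.
move=> b c /(congr1 (gadd (⊖ a))); rewrite !gyr_assoc gadd_oppl !gadd_idl.
exact: (bij_inj (gyr_bij _ _)).
Qed.

Lemma gyr_idl a : gyr gid a =1 id.
Proof.
move=> c; apply: (@gadd_cancel a).
by rewrite -[in RHS](gadd_idl (a ⊕ c)) gyr_assoc gadd_idl.
Qed.

Lemma gyr_oppl a : gyr (⊖ a) a =1 id.
Proof. by move=> c; rewrite -gyr_loop gadd_oppl gyr_idl. Qed.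

Lemma gadd_oppK a b : ⊖ a ⊕ (a ⊕ b) = b.
Proof. by rewrite gyr_assoc gadd_oppl gadd_idl gyr_oppl. Qed.

Lemma gadd_idr a : a ⊕ gid = a.
Proof. by apply: (@gadd_cancel (⊖ a)); rewrite gadd_oppK gadd_oppl. Qed.

Lemma gadd_oppr a : a ⊕ ⊖ a = gid.
Proof.
apply: (@gadd_cancel (⊖ a)).
by rewrite gadd_oppK gadd_idr.
Qed.

Lemma gyro_idP x : left_id x (@gadd G) -> x = gid.
Proof. by move=> /(_ gid); rewrite gadd_idr. Qed.

Lemma goppP a b : b ⊕ a = gid -> b = ⊖ a.
Proof.
move=> ba; have -> : a = ⊖ b by apply: (@gadd_cancel b); rewrite gadd_oppr.
by apply: (@gadd_cancel (⊖ b)); rewrite gadd_oppl gadd_oppr.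
Qed.

Lemma gyrP a b (g : G -> G) :
  (forall c, a ⊕ (b ⊕ c) = (a ⊕ b) ⊕ g c) -> g =1 gyr a b.
Proof. by move=> gE c; apply: (@gadd_cancel (a ⊕ b)); rewrite -gE gyr_assoc. Qed.

End GyrogroupTheory.

(* F^o is F as a vector space over itself, which makes {ffun G -> F^o} a
   vectType. *)
Notation Lfun G F := {ffun G -> F^o}.

Section FunctionSpace.
Variables (G : finGyrogroupType) (F : fieldType).

Implicit Types (f : Lfun G F) (a x y z : G).

Definition sigma f : F^o := \sum_(a : G) f a.

Fact sigma_is_linear : linear sigma.
Proof.
move=> k f g; rewrite /sigma scaler_sumr -big_split /=.
by apply: eq_bigr => a _; rewrite !ffunE.
Qed.
HB.instance Definition _ :=
  GRing.isLinear.Build F (Lfun G F) F^o *:%R sigma sigma_is_linear.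

Definition gyr_defect a x y z f : F^o := f (a ⊕ gyr x y z) - f (a ⊕ z).

Fact gyr_defect_is_linear a x y z : linear (gyr_defect a x y z).
Proof. by move=> k f g; rewrite /gyr_defect !ffunE scalerBr opprD addrACA. Qed.
HB.instance Definition _ a x y z :=
  GRing.isLinear.Build F (Lfun G F) F^o *:%R (gyr_defect a x y z)
    (gyr_defect_is_linear a x y z).

Definition Lgyr : {vspace Lfun G F} :=
  (\bigcap_(a : G) \bigcap_(x : G) \bigcap_(y : G) \bigcap_(z : G)
     lker (linfun (gyr_defect a x y z)))%VS.

Lemma LgyrP f :
  reflect (forall a x y z, f (a ⊕ gyr x y z) = f (a ⊕ z)) (f \in Lgyr).
Proof.
apply: (iffP idP) => [fL a x y z | fE].
  apply/eqP; rewrite -subr_eq0 -/(gyr_defect a x y z f).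
  have: f \in lker (linfun (gyr_defect a x y z)).
    apply: (subvP _ _ fL); apply: (bigcapv_inf a) => //.
    apply: (bigcapv_inf x) => //; apply: (bigcapv_inf y) => //.
    exact: (bigcapv_inf z).
  by rewrite memv_ker lfunE.
rewrite memvE; do 4![apply/subv_bigcapP => ? _].
by rewrite -memvE memv_ker lfunE /= /gyr_defect fE subrr.
Qed.

Definition ker_sigma : {vspace Lfun G F} := lker (linfun sigma).

Lemma mem_ker_sigma f : (f \in ker_sigma) = (sigma f == 0).
Proof. by rewrite memv_ker lfunE. Qed.

Definition left_regular a f : Lfun G F := [ffun x => f (⊖ a ⊕ x)].

Definition invariant_subspace (W : {vspace Lfun G F}) : Prop :=
  (W <= Lgyr)%VS /\ forall a f, f \in W -> left_regular a f \in W.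

End FunctionSpace.

(* Main.v *)
Require Import Defs.
From HB Require Import structures.
From mathcomp Require Import all_boot all_order all_algebra.

Set Implicit Arguments.
Unset Strict Implicit.
Unset Printing Implicit Defensive.

Import GRing.Theory.
Local Open Scope ring_scope.

(* An invariant complement W of the kernel of sigma contains some w with
   sigma w != 0. As left translation preserves sigma, a.w - w lies both in W
   and in the kernel, so a.w = w for every a, i.e. w is constant. Then sigma w
   is a multiple of |G|, which is 0 in F. *)

(** By left cancellation [x ↦ ⊖ a ⊕ x] is injective, so it permutes the finite [G] and reindexes the
    sum. *)
Lemma sigma_left_regular (G : finGyrogroupType) (F : fieldType) (a : G)
    (f : Lfun G F) :
  sigma (left_regular a f) = sigma f.
Proof.
rewrite /sigma [RHS](reindex_inj (@gadd_cancel G (gopp a))) /=.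
by apply: eq_bigr => x _; rewrite ffunE.
Qed.

(** Invariance under translation by the point [x] itself carries the value at [x] to the one at
    [⊖ x ⊕ x]. *)
Lemma left_regular_fixed_const (G : finGyrogroupType) (F : fieldType)
    (f : Lfun G F) :
  (forall a, left_regular a f = f) -> forall x, f x = f (@gid G).
Proof. by move=> fE x; rewrite -[in LHS](fE x) ffunE gadd_oppl. Qed.

Theorem theorem5p1 (G : finGyrogroupType) (F : fieldType) (p : nat)
    (charF : p \in [pchar F]) (p_dvd_G : (p %| #|G|)%N)
    (sigma_neq0 : exists f : Lfun G F, f \in Lgyr G F /\ sigma f <> 0) :
  ~ exists W : {vspace Lfun G F},
      [/\ invariant_subspace W,
          (Lgyr G F :&: ker_sigma G F + W)%VS = Lgyr G F &
          directv (Lgyr G F :&: ker_sigma G F + W)].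
Proof.
case=> W [[WL Winv] LE /directv_addP capW0].
case: sigma_neq0 => f []; rewrite -LE => /memv_addP[k kK [w wW ->]].
move: kK; rewrite memv_cap mem_ker_sigma => /andP[_ /eqP k0].
(* What remains is to refute [sigma w <> 0], so the goal becomes [sigma w = 0]. *)
rewrite linearD /= k0 add0r; apply.
have wE a : left_regular a w = w.
  have dW : left_regular a w - w \in W by rewrite memvB // Winv.
  (* The difference lies in [Lgyr] because [W] does. *)
  apply/eqP; rewrite -subr_eq0 -memv0 -capW0 !memv_cap dW (subvP WL _ dW).
  by rewrite mem_ker_sigma linearB /= sigma_left_regular subrr eqxx.
rewrite /sigma (eq_bigr _ (fun x _ => left_regular_fixed_const wE x)).
rewrite sumr_const -mulr_natl.
by move: p_dvd_G; rewrite (dvdn_pcharf charF) => /eqP ->; rewrite mul0r.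
Qed.
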